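(* Let $p$ be an odd prime. Then $$\sum_{k=0}^{p-1}\frac{3k+1}{(-16)^k}\binom{2k}{k} f_k \equiv p\,(-1)^{\frac{p-1}{2}} \pmod{p^3}.$$
   Context: The Franel numbers are defined by $f_n=\sum_{k=0}^n \binom{n}{k}^3$ for integers $n\ge 0$. The left-hand side is a rational number whose denominator is a power of $2$, hence coprime to $p$; a congruence $a\equiv b \pmod{p^r}$ between such rationals means that $a-b$ is a rational number whose numerator (in lowest terms) is divisible by $p^r$ and whose denominator is coprime to $p$. *)

(* Defs.v *)
From HB Require Import structures.
From mathcomp Require Import all_boot all_order all_algebra.
Set Implicit Arguments. Unset Strict Implicit. Unset Printing Implicit Defensive.
Import Order.TTheory GRing.Theory Num.Theory.

Definition franel (n : nat) : nat := \sum_(0 <= k < n.+1) 'C(n, k) ^ 3.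

Definition rat_congr (m : nat) (a b : rat) : Prop :=
  (m%:Z %| numq (a - b))%Z /\ coprime `|denq (a - b)|%N m.

(* Main.v *)
Require Import Defs.
From HB Require Import structures.
From mathcomp Require Import all_boot all_order all_algebra.
From mathcomp Require Import ring lra zify.
Import Order.TTheory GRing.Theory Num.Theory.
Local Open Scope ring_scope.

(** Zeilberger's algorithm gives the same three-term recurrence for both sides of
      f_n = sum_k C(n+2k,3k) C(3k,k) C(2k,k) (-4)^(n-k).
    After this substitution the sum over n is summable in closed form, and with
    t_k = C(p-1,k) C(p+2k,2k) C(2k,k) / ((2k+1) (-4)^k) the left-hand side is
      S = 2 p^2 C(2p,p) / 4^p * sum_(k<p) t_k.
    Put p = 2m+1, s = (-1)^m, u = 4^m = 2^(p-1), B = C(p-1,m) and c = C(2p,p)/2,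
    so that S = p c u^-2 * sum_k p t_k. Modulo p^2 the terms p t_k with k > m
    vanish, p t_m = s B^2 c / u, and for k < m the term p t_k is congruent to
    p (-1)^k C(m,k) / (2k+1), since C(2k,k) / (-4)^k = C(m,k) mod p; by partial
    fractions the latter add up to u/B - s. As c = 1 and B = s u^2 mod p^2 (a weak
    form of Morley's congruence), S/p - s becomes s u^-3 (u-1) (u^3-1), which
    Fermat's little theorem makes divisible by p^2. *)

(** * Binomial coefficients as quotients of factorials *)

Lemma natr_neq0 (n : nat) : (0 < n)%N -> n%:R != 0 :> rat.
Proof. by rewrite pnatr_eq0 lt0n. Qed.

Lemma factr_neq0 (n : nat) : n`!%:R != 0 :> rat.
Proof. by apply: natr_neq0; apply: fact_gt0. Qed.

Lemma factrS (n : nat) : n.+1`!%:R = (n%:R + 1) * n`!%:R :> rat.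
Proof. by rewrite factS natrM -natr1. Qed.

Lemma binr_fact (n k d : nat) : (k + d = n)%N ->
  'C(n, k)%:R = n`!%:R / (k`!%:R * d`!%:R) :> rat.
Proof.
move=> <-; rewrite -(@bin_fact (k + d) k) ?leq_addr // addKn !natrM.
by rewrite mulfK // mulf_neq0 ?factr_neq0.
Qed.

(** The factor d keeps the formula valid at d = 0, where k = n+1 and the binomial vanishes. Together
    with [binr_factSS] it puts C(n,k), C(n+1,k) and C(n+2,k) over the same k! d! with d = n+2-k. *)
Lemma binr_factS (n k d : nat) : (k + d = n.+1)%N ->
  'C(n, k)%:R = n`!%:R * d%:R / (k`!%:R * d`!%:R) :> rat.
Proof.
case: d => [|d] e; first by rewrite bin_small ?mulr0 ?mul0r //; lia.
rewrite (@binr_fact n k d) ?factrS -?natr1; last lia.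
have := @factr_neq0 k; have := @factr_neq0 d.
have := @natr_neq0 d.+1 isT; rewrite -natr1 => h1 h2 h3.
by field; rewrite h1 h2 h3.
Qed.

Lemma binr_factSS (n k d : nat) : (k + d = n.+2)%N ->
  'C(n, k)%:R = n`!%:R * d%:R * (d%:R - 1) / (k`!%:R * d`!%:R) :> rat.
Proof.
case: d => [|d] e; first by rewrite bin_small ?mulr0 ?mul0r //; lia.
rewrite (@binr_factS n k d) ?factrS -?natr1; last lia.
have := @factr_neq0 k; have := @factr_neq0 d.
have := @natr_neq0 d.+1 isT; rewrite -natr1 => h1 h2 h3.
by field; rewrite h1 h2 h3.
Qed.

(** * The recurrence of the Franel numbers *)

(** Franel's recurrence (n+1)^2 f_(n+1) = (7n^2+7n+2) f_n + 8n^2 f_(n-1), with n replaced by n+1. *)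
Definition franel_rec (a : nat -> rat) : Prop := forall n : nat,
  (n%:R + 2) ^+ 2 * a n.+2 =
  (7 * n%:R ^+ 2 + 21 * n%:R + 16) * a n.+1 + 8 * (n%:R + 1) ^+ 2 * a n.

Lemma franel_rec_unique (a b : nat -> rat) :
  franel_rec a -> franel_rec b -> a 0%N = b 0%N -> a 1%N = b 1%N -> a =1 b.
Proof.
move=> ra rb e0 e1 n; suff: a n = b n /\ a n.+1 = b n.+1 by case.
elim: n => [//|n [en en1]]; split=> //.
have h : (n%:R + 2) ^+ 2 != 0 :> rat.
  by rewrite expf_neq0 // -natrD natr_neq0 // addnS.
by apply: (mulfI h); rewrite ra rb en en1.
Qed.

Lemma sum_nat_support (n M : nat) (F : nat -> rat) : (n <= M)%N ->
  (forall k, (n <= k)%N -> F k = 0) ->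
  \sum_(0 <= k < M) F k = \sum_(0 <= k < n) F k.
Proof.
move=> le_nM F0; rewrite (@big_cat_nat _ _ _ n) //= [X in _ + X]big_nat_cond.
by rewrite [X in _ + X]big1 ?addr0 // => k /andP[/andP[h _] _]; apply: F0.
Qed.

Lemma franelE (n M : nat) : (n < M)%N ->
  (franel n)%:R = \sum_(0 <= k < M) 'C(n, k)%:R ^+ 3 :> rat.
Proof.
move=> ltnM; rewrite (@sum_nat_support n.+1) // => [|k h]; last first.
  by rewrite bin_small // expr0n.
by rewrite /franel natr_sum; apply: eq_bigr => k _; rewrite natrX.
Qed.

(* The polynomial factor of Zeilberger's certificate for the sum of the C(n,k)^3. *)
Definition franel_cert (n k : rat) : rat :=
  n ^+ 2 * (4 * k ^+ 3 - 12 * k ^+ 2 - 18 * n * k ^+ 2 + 12 * k + 39 * n * k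
    + 27 * n ^+ 2 * k - 4 - 22 * n - 32 * n ^+ 2 - 14 * n ^+ 3).

(** Induction on k: one more summand moves the certificate from k to k+1, an identity of rational
    functions once the binomials share their factorials. *)
Lemma franel_telescope (n k d : nat) : (k + d = n.+2)%N ->
  \sum_(0 <= j < k) ((n%:R + 2) ^+ 2 * 'C(n.+2, j)%:R ^+ 3
    - (7 * n%:R ^+ 2 + 21 * n%:R + 16) * 'C(n.+1, j)%:R ^+ 3
    - 8 * (n%:R + 1) ^+ 2 * 'C(n, j)%:R ^+ 3) =
  k%:R ^+ 3 * franel_cert (n%:R + 1) k%:R * (n`!%:R / (k`!%:R * d`!%:R)) ^+ 3
  :> rat.
Proof.
elim: k d => [|k IHk] d e; first by rewrite big_nil expr0n !mul0r.
have e' : (k + d.+1 = n.+2)%N by lia.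
rewrite big_nat_recr //= (IHk d.+1) //.
rewrite (binr_fact _ _ _ e') (binr_factS _ _ _ e') (binr_factSS _ _ _ e').
rewrite !factrS -!natr1.
have en : d%:R = n%:R + 1 - k%:R :> rat.
  have := congr1 (fun i : nat => i%:R : rat) e'.
  by rewrite natrD -!natr1 => h; lra.
have := @factr_neq0 k; have := @factr_neq0 d.
have := @natr_neq0 d.+1 isT; rewrite -natr1.
have := @natr_neq0 k.+1 isT; rewrite -natr1.
rewrite /franel_cert -natr1 en => h1 h2 h3 h4.
by field; rewrite h1 h2 h3 h4.
Qed.

Lemma franel_numbers_rec : franel_rec (fun n => (franel n)%:R).
Proof.
move=> n; rewrite (@franelE n n.+3); last lia.
rewrite (@franelE n.+1 n.+3) 1?(@franelE n.+2 n.+3) //.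
apply/eqP; rewrite -subr_eq0 opprD addrA !mulr_sumr -!sumrB.
(* Telescoping covers j < n+2. At j = n+2 only C(n+2,n+2) = 1 survives, and the certificate cancels
   its coefficient (n+2)^2. *)
rewrite big_nat_recr //= (@franel_telescope n n.+2 0) ?addn0 //.
rewrite binn !bin_small // !expr0n /= !mulr0 !subr0 expr1n mulr1 fact0 mulr1.
have -> : n`!%:R / n.+2`!%:R = ((n%:R + 1) * (n%:R + 2))^-1 :> rat.
  have := @natr_neq0 n.+1 isT; have := @natr_neq0 n.+2 isT; have := @factr_neq0 n.
  rewrite !factrS -!natr1 -addrA => h1 h2 h3.
  by field; rewrite h1 h2 h3.
have := @natr_neq0 n.+1 isT; have := @natr_neq0 n.+2 isT.
rewrite /franel_cert -!natr1 -addrA => h2 h3; apply/eqP.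
by field; rewrite h2 h3.
Qed.

(** * A second sum for the Franel numbers *)

(** The power (-4)^(n-k) is a quotient, which avoids truncated subtraction; for k > n the first
    binomial vanishes. *)
Definition franel_term (n k : nat) : rat :=
  'C(n + 2 * k, 3 * k)%:R * 'C(3 * k, k)%:R * 'C(2 * k, k)%:R
  * (-4) ^+ n / (-4) ^+ k.

Lemma franel_term_small (n k : nat) : (n < k)%N -> franel_term n k = 0.
Proof. by move=> h; rewrite /franel_term bin_small ?mul0r //; lia. Qed.

Lemma multinomial_fact (n k d : nat) : (k + d = n)%N ->
  'C(n + 2 * k, 3 * k)%:R * 'C(3 * k, k)%:R * 'C(2 * k, k)%:R =
  (n + 2 * k)`!%:R / (d`!%:R * k`!%:R ^+ 3) :> rat.
Proof.
move=> e; rewrite (@binr_fact _ (3 * k) d); last lia.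
rewrite (@binr_fact _ k (2 * k)) 1?(@binr_fact _ k k); try lia.
have := @factr_neq0 k; have := @factr_neq0 d.
have := @factr_neq0 (2 * k); have := @factr_neq0 (3 * k).
by move=> h1 h2 h3 h4; field; rewrite h1 h2 h3 h4.
Qed.

Lemma franel_term_fact (n k d : nat) : (k + d = n)%N ->
  franel_term n k =
  (n + 2 * k)`!%:R / (d`!%:R * k`!%:R ^+ 3) * (-4) ^+ n / (-4) ^+ k.
Proof. by move=> e; rewrite /franel_term (multinomial_fact _ _ _ e). Qed.

Lemma franel_term_factS (n k d : nat) : (k + d = n.+1)%N ->
  franel_term n k =
  (n + 2 * k)`!%:R * d%:R / (d`!%:R * k`!%:R ^+ 3) * (-4) ^+ n / (-4) ^+ k.
Proof.
case: d => [|d] e; first by rewrite franel_term_small ?mulr0 ?mul0r //; lia.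
rewrite (@franel_term_fact n k d) ?factrS -?natr1; last lia.
have := @factr_neq0 k; have := @factr_neq0 d.
have := @natr_neq0 d.+1 isT; rewrite -natr1 => h1 h2 h3.
by field; rewrite h1 h2 h3 expf_neq0.
Qed.

Lemma franel_term_factSS (n k d : nat) : (k + d = n.+2)%N ->
  franel_term n k = (n + 2 * k)`!%:R * d%:R * (d%:R - 1)
    / (d`!%:R * k`!%:R ^+ 3) * (-4) ^+ n / (-4) ^+ k.
Proof.
case: d => [|d] e; first by rewrite franel_term_small ?mulr0 ?mul0r //; lia.
rewrite (@franel_term_factS n k d) ?factrS -?natr1; last lia.
have := @factr_neq0 k; have := @factr_neq0 d.
have := @natr_neq0 d.+1 isT; rewrite -natr1 => h1 h2 h3.
by field; rewrite h1 h2 h3 expf_neq0.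
Qed.

(* The right-hand side is Zeilberger's certificate. *)
Lemma franel_term_telescope (n k d : nat) : (k + d = n.+2)%N ->
  \sum_(0 <= j < k) ((n%:R + 2) ^+ 2 * franel_term n.+2 j
    - (7 * n%:R ^+ 2 + 21 * n%:R + 16) * franel_term n.+1 j
    - 8 * (n%:R + 1) ^+ 2 * franel_term n j) =
  - 48 * (3 * n%:R + 5) * k%:R ^+ 3 * (n + 2 * k)`!%:R
    / (d`!%:R * k`!%:R ^+ 3) * (-4) ^+ n / (-4) ^+ k.
Proof.
elim: k d => [|k IHk] d e; first by rewrite big_nil expr0n /= mulr0 !mul0r.
have e' : (k + d.+1 = n.+2)%N by lia.
rewrite big_nat_recr //= (IHk d.+1) //.
rewrite (franel_term_fact _ _ _ e') (franel_term_factS _ _ _ e').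
rewrite (franel_term_factSS _ _ _ e').
have -> : (n + 2 * k.+1 = (n + 2 * k).+2)%N by lia.
rewrite !addSn !factrS !exprS -!natr1 natrD natrM.
have en : d%:R = n%:R + 1 - k%:R :> rat.
  have := congr1 (fun i : nat => i%:R : rat) e'.
  by rewrite natrD -!natr1 => h; lra.
have := @factr_neq0 k; have := @factr_neq0 d.
have := @natr_neq0 d.+1 isT; rewrite -natr1.
have := @natr_neq0 k.+1 isT; rewrite -natr1.
rewrite en => h1 h2 h3 h4.
by field; rewrite h1 h2 h3 h4 expf_neq0.
Qed.

Lemma sum_franel_term_widen (n M : nat) : (n < M)%N ->
  \sum_(0 <= k < M) franel_term n k = \sum_(0 <= k < n.+1) franel_term n k.
Proof.
move=> h; apply: sum_nat_support => // k hk.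
exact: franel_term_small.
Qed.

Lemma franel_term_sum_rec :
  franel_rec (fun n => \sum_(0 <= k < n.+1) franel_term n k).
Proof.
move=> n; rewrite -(@sum_franel_term_widen n n.+3); last lia.
rewrite -(@sum_franel_term_widen n.+1 n.+3); last lia.
apply/eqP; rewrite -subr_eq0 opprD addrA !mulr_sumr -!sumrB.
rewrite big_nat_recr //= (@franel_term_telescope n n.+2 0) ?addn0 //.
rewrite (@franel_term_fact n.+2 n.+2 0) ?addn0 //.
rewrite !(@franel_term_small _ n.+2) //.
have -> : (n.+2 + 2 * n.+2 = (n + 2 * n.+2).+2)%N by lia.
rewrite !factrS !exprS -!natr1 natrD natrM -!natr1.
have := @natr_neq0 n.+1 isT; have := @natr_neq0 n.+2 isT; have := @factr_neq0 n.
rewrite -!natr1 => h1 h2 h3.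
by apply/eqP; field; rewrite h1 h2 h3 expf_neq0.
Qed.

(** Both sums satisfy the recurrence and start with 1, 2. The free bound M lets one range of k serve
    all n < M. *)
Lemma franel_sum_term (n M : nat) : (n < M)%N ->
  (franel n)%:R = \sum_(0 <= k < M) franel_term n k.
Proof.
move=> ltnM; rewrite sum_franel_term_widen //.
apply: (franel_rec_unique _ _ franel_numbers_rec franel_term_sum_rec).
  by rewrite /franel !big_nat1.
by rewrite /franel !big_nat_recr //= !big_nil.
Qed.

(** * Closed form of the summation over n *)

Lemma central_binS (n : nat) :
  'C(2 * n.+1, n.+1)%:R = 2 * (2 * n%:R + 1) / (n%:R + 1) * 'C(2 * n, n)%:R :> rat.
Proof.
rewrite (@binr_fact (2 * n.+1) n.+1 n.+1) 1?(@binr_fact (2 * n) n n); try lia.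
have -> : (2 * n.+1 = (2 * n).+2)%N by lia.
rewrite !factrS -!natr1 natrM.
have := @factr_neq0 n; have := @natr_neq0 n.+1 isT; rewrite -natr1 => h1 h2.
by field; rewrite h1 h2.
Qed.

(** Multiplied out, the ratio of consecutive binomials also makes sense at k = n+1, where n+1-k
    vanishes. *)
Lemma binS_shift (n k : nat) :
  (n%:R + 1 - k%:R) * 'C(n.+1 + 2 * k, 3 * k)%:R =
  (n%:R + 2 * k%:R + 1) * 'C(n + 2 * k, 3 * k)%:R :> rat.
Proof.
have -> : n%:R + 2 * k%:R + 1 = (n.+1 + 2 * k)%:R :> rat.
  by rewrite natrD natrM -natr1; ring.
have := mul_bin_down (n.+1 + 2 * k) (3 * k).
rewrite {1}addSn /= => e; rewrite -natrM e natrM.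
have [h|h] := leqP k n.+1.
  have -> : (n.+1 + 2 * k - 3 * k = n.+1 - k)%N by lia.
  by rewrite natrB // -natr1.
by rewrite bin_small ?mulr0 //; lia.
Qed.

Lemma inner_sum (N k : nat) :
  \sum_(0 <= n < N) (3 * n + 1)%:R / 4 ^+ n * 'C(2 * n, n)%:R
      * 'C(n + 2 * k, 3 * k)%:R =
  2 * N%:R * (N%:R - k%:R) / (2 * k%:R + 1) * 'C(2 * N, N)%:R
    * 'C(N + 2 * k, 3 * k)%:R / 4 ^+ N :> rat.
Proof.
have hk : 2 * k%:R + 1 != 0 :> rat.
  by rewrite -natrM natr1 natr_neq0.
elim: N => [|N IHN]; first by rewrite big_nil mulr0 !mul0r.
rewrite big_nat_recr //= IHN central_binS exprS -natr1.
have hN : N%:R + 1 != 0 :> rat by rewrite natr1 natr_neq0.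
set c := 'C(2 * N, N)%:R; set e := 'C(N + 2 * k, 3 * k)%:R.
(* The numerator 2N(N-k) + (3N+1)(2k+1) obtained by adding the term n = N factors as (2N+1)(N+2k+1);
   [binS_shift] absorbs the second factor. *)
transitivity (2 * (N%:R + 1) / (2 * k%:R + 1)
  * (2 * (2 * N%:R + 1) / (N%:R + 1) * c)
  * ((N%:R + 2 * k%:R + 1) * e) / (4 * 4 ^+ N) : rat).
  by rewrite natrD natrM; field; rewrite hk hN expf_neq0.
rewrite -binS_shift; field; by rewrite hk hN expf_neq0.
Qed.

(** Both sides are (N-k) (N+2k)! / ((N-k)! k!^3). The right-hand form extracts a second factor N,
    which supplies p^2 when N = p. *)
Lemma trinomial_rearrange (N k : nat) : (k < N)%N ->
  (N%:R - k%:R) * 'C(N + 2 * k, 3 * k)%:R * 'C(3 * k, k)%:R * 'C(2 * k, k)%:R =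
  N%:R * 'C(N.-1, k)%:R * 'C(N + 2 * k, 2 * k)%:R * 'C(2 * k, k)%:R :> rat.
Proof.
case: N => // N; rewrite ltnS => le_kN.
have [d e] : exists d, (k + d = N)%N by exists (N - k)%N; lia.
have := @multinomial_fact N.+1 k d.+1 (ltac:(lia)).
rewrite -!mulrA => ->; rewrite (binr_fact _ _ _ e).
rewrite (@binr_fact _ (2 * k) N.+1) 1?(@binr_fact _ k k); try lia.
rewrite !factrS -!natr1.
have -> : N%:R = k%:R + d%:R :> rat by rewrite -natrD e.
have := @factr_neq0 k; have := @factr_neq0 d; have := @factr_neq0 (2 * k).
have := @factr_neq0 N.
have := @natr_neq0 d.+1 isT; have := @natr_neq0 N.+1 isT.
rewrite -!natr1 -{1}e natrD => h1 h2 h3 h4 h5 h6.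
by field; rewrite h1 h2 h3 h4 h5 h6.
Qed.

Lemma franel_sumE (N : nat) :
  \sum_(0 <= k < N) ((3 * k + 1)%:R / (-16 : rat) ^+ k * 'C(2 * k, k)%:R
     * (franel k)%:R) =
  2 * N%:R ^+ 2 * 'C(2 * N, N)%:R / 4 ^+ N
  * \sum_(0 <= k < N) 'C(N.-1, k)%:R * 'C(N + 2 * k, 2 * k)%:R
      * ('C(2 * k, k)%:R / (-4) ^+ k) / (2 * k%:R + 1).
Proof.
(* Taking k < N for every n makes the range rectangular, so that the sums can be exchanged; -16 = 4
   * -4 cancels the power (-4)^n. *)
transitivity (\sum_(0 <= n < N) \sum_(0 <= k < N)
    'C(3 * k, k)%:R * 'C(2 * k, k)%:R / (-4) ^+ k * ((3 * n + 1)%:R / 4 ^+ n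
    * 'C(2 * n, n)%:R * 'C(n + 2 * k, 3 * k)%:R) : rat).
  apply: eq_big_nat => n /andP[_ hn].
  rewrite (@franel_sum_term n N) // mulr_sumr; apply: eq_bigr => k _.
  rewrite /franel_term -[-16]/(4 * -4 : rat) exprMn.
  by field; rewrite !expf_neq0.
rewrite exchange_big_nat /= mulr_sumr; apply: eq_big_nat => k /andP[_ hk].
rewrite -mulr_sumr inner_sum.
transitivity (2 * N%:R * 'C(2 * N, N)%:R / 4 ^+ N / (-4) ^+ k / (2 * k%:R + 1)
  * ((N%:R - k%:R) * 'C(N + 2 * k, 3 * k)%:R * 'C(3 * k, k)%:R
      * 'C(2 * k, k)%:R) : rat); last rewrite trinomial_rearrange //.
all: have h : 2 * k%:R + 1 != 0 :> rat by rewrite -natrM natr1 natr_neq0.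
all: by field; rewrite h !expf_neq0.
Qed.

(** * Divisibility by powers of p among p-integral rationals *)

(* [x] lies in [p ^ r Z_(p)]. *)
Definition pdvd (p r : nat) (x : rat) : Prop :=
  exists2 b : nat, coprime p b & exists a : int, x * b%:R = (p ^ r)%:R * a%:~R.

Lemma pdvdD (p r : nat) (x y : rat) : pdvd p r x -> pdvd p r y -> pdvd p r (x + y).
Proof.
move=> [b cb [a ea]] [d cd [c ec]]; exists (b * d)%N; first by rewrite coprimeMr cb.
exists (a * d%:Z + c * b%:Z); rewrite natrM rmorphD !rmorphM /=.
transitivity (x * b%:R * d%:R + y * d%:R * b%:R); first by ring.
by rewrite ea ec; ring.
Qed.

Lemma pdvdN (p r : nat) (x : rat) : pdvd p r x -> pdvd p r (- x).
Proof.
move=> [b cb [a ea]]; exists b => //; exists (- a).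
by rewrite mulNr ea rmorphN mulrN.
Qed.

Lemma pdvdB (p r : nat) (x y : rat) : pdvd p r x -> pdvd p r y -> pdvd p r (x - y).
Proof. by move=> hx hy; apply/pdvdD/pdvdN. Qed.

Lemma pdvdM (p r s : nat) (x y : rat) :
  pdvd p r x -> pdvd p s y -> pdvd p (r + s) (x * y).
Proof.
move=> [b cb [a ea]] [d cd [c ec]]; exists (b * d)%N; first by rewrite coprimeMr cb.
exists (a * c); rewrite rmorphM /= expnD !natrM.
by rewrite mulrACA ea ec; ring.
Qed.

Lemma pdvdMl (p r : nat) (x y : rat) : pdvd p 0 x -> pdvd p r y -> pdvd p r (x * y).
Proof. exact: pdvdM. Qed.

Lemma pdvdMr (p r : nat) (x y : rat) : pdvd p r x -> pdvd p 0 y -> pdvd p r (x * y).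
Proof. by move=> hx hy; rewrite -(addn0 r); apply: pdvdM. Qed.

Lemma pdvd0 (p r : nat) : pdvd p r 0.
Proof. by exists 1%N; [exact: coprimen1 | exists 0; rewrite mul0r mulr0]. Qed.

Lemma pdvd_sum (p r m n : nat) (F : nat -> rat) :
  (forall i, (m <= i < n)%N -> pdvd p r (F i)) -> pdvd p r (\sum_(m <= i < n) F i).
Proof.
move=> h; rewrite big_nat; elim/big_ind: _ => //; first exact: pdvd0.
by move=> x y; apply: pdvdD.
Qed.

Lemma pdvd_nat (p r n : nat) : (p ^ r %| n)%N -> pdvd p r n%:R.
Proof.
move=> /dvdnP[q ->]; exists 1%N; first exact: coprimen1.
by exists q%:Z; rewrite mulr1 natrM mulrC.
Qed.

Lemma pint_nat (p n : nat) : pdvd p 0 n%:R.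
Proof. by apply: pdvd_nat; apply: dvd1n. Qed.

Lemma pint_sign (p k : nat) : pdvd p 0 ((-1) ^+ k).
Proof.
exists 1%N; first exact: coprimen1.
by exists ((-1) ^+ k); rewrite rmorphXn /= mulr1 mul1r.
Qed.

Lemma pint_inv (p b : nat) : (0 < b)%N -> coprime p b -> pdvd p 0 b%:R^-1.
Proof.
move=> b0 cb; exists b => //; exists 1.
by rewrite mulVf ?natr_neq0.
Qed.

Lemma pdvdW (p r s : nat) (x : rat) : (r <= s)%N -> pdvd p s x -> pdvd p r x.
Proof.
move=> le_rs [b cb [a ea]]; exists b => //; exists ((p ^ (s - r))%N%:Z * a).
by rewrite ea rmorphM /= mulrA -natrM -expnD subnKC.
Qed.

Lemma pdvd_mul_congr (p r : nat) (x x' y y' : rat) :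
  pdvd p 0 x -> pdvd p 0 y' -> pdvd p r (x - x') -> pdvd p r (y - y') ->
  pdvd p r (x * y - x' * y').
Proof.
move=> hx hy' hxx hyy.
have -> : x * y - x' * y' = x * (y - y') + (x - x') * y' by ring.
by apply: pdvdD; [apply: pdvdMl | apply: pdvdMr].
Qed.

Lemma pdvd_trans (p r : nat) (x y z : rat) :
  pdvd p r (x - y) -> pdvd p r (y - z) -> pdvd p r (x - z).
Proof. by move=> h1 h2; have := pdvdD _ _ _ _ h1 h2; rewrite addrA subrK. Qed.

Lemma pint_congr (p r : nat) (x y : rat) : pdvd p r (x - y) -> pdvd p 0 y -> pdvd p 0 x.
Proof. by move=> h hy; rewrite -(subrK y x); apply: pdvdD => //; apply: pdvdW h. Qed.

(** In num * b = p^r * a * den, Gauss's lemma gives p^r | num because b is coprime to p, and den | b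
    because den is coprime to num. *)
Lemma pdvd_rat_congr (p r : nat) (x y : rat) : prime p ->
  pdvd p r (x - y) -> rat_congr (p ^ r) x y.
Proof.
move=> pp; rewrite /rat_congr; set z := x - y => -[b cb [a ea]].
have b0 : (0 < b)%N.
  by case: b cb {ea} => //; rewrite /coprime gcdn0 => /eqP h; rewrite h in pp.
have ez : numq z * b%:Z = (p ^ r)%N%:Z * a * denq z.
  apply: (@intr_inj rat); rewrite !rmorphM /= -[(b%:Z)%:~R]/(b%:R).
  rewrite -[((p ^ r)%N%:Z)%:~R]/((p ^ r)%:R) -ea -{2}[z]divq_num_den.
  by field; rewrite intr_eq0 denq_eq0.
have cpb : coprime (p ^ r) b by rewrite coprimeXl.
split.
  rewrite -(@Gauss_dvdzl (p ^ r)%N%:Z (numq z) b%:Z) ?ez; last first.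
    by rewrite /coprimez /gcdz /= eqz_nat.
  by rewrite -mulrA dvdz_mulr.
have hd : (denq z %| b%:Z)%Z.
  rewrite -(@Gauss_dvdzr _ (numq z)); first by rewrite ez dvdz_mull.
  rewrite coprimez_sym /coprimez /gcdz.
  by have := coprime_num_den z; rewrite /coprime => /eqP ->.
apply: coprime_dvdl (_ : (`|denq z| %| b)%N) _; first exact: hd.
by rewrite coprime_sym.
Qed.

(** * Binomial coefficients and powers of 2 modulo p and p^2 *)

Lemma coprime_small (p k : nat) : prime p -> (0 < k < p)%N -> coprime p k.
Proof. by move=> pp /andP[k0 kp]; rewrite prime_coprime // gtnNdvd. Qed.

Lemma pint_invS (p k : nat) : prime p -> (k.+1 < p)%N -> pdvd p 0 (k%:R + 1)^-1.
Proof. by move=> pp hk; rewrite natr1; apply: pint_inv => //; apply: coprime_small. Qed.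

Lemma pdvd_prime (p : nat) : pdvd p 1 p%:R.
Proof. by apply: pdvd_nat; rewrite expn1. Qed.

(** By Vandermonde C(2p,p) is the sum of C(p,j) C(p,p-j): the two end terms give 2, and in each
    other term both factors are divisible by p. *)
Lemma bin_2p_congr (p : nat) : prime p -> pdvd p 2 ('C(2 * p, p)%:R - 2).
Proof.
move=> pp; rewrite mul2n -addnn -binomial.Vandermonde.
rewrite -(big_mkord predT (fun j => 'C(p, j) * 'C(p, p - j))%N).
rewrite natr_sum big_nat_recr //= big_ltn ?prime_gt0 //.
rewrite subn0 subnn !bin0 !binn.
rewrite (_ : _ - 2 = \sum_(1 <= i < p) ('C(p, i) * 'C(p, p - i))%:R); last by ring.
apply: pdvd_sum => i hi; rewrite bin_sub; last lia.
by rewrite natrM; apply: (@pdvdM p 1 1); apply: pdvd_nat; rewrite expn1 prime_dvd_bin.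
Qed.

Definition harmonic (n : nat) : rat := \sum_(0 <= j < n) (j%:R + 1)^-1.

Lemma pint_harmonic (p n : nat) : prime p -> (n < p)%N -> pdvd p 0 (harmonic n).
Proof. by move=> pp hn; apply: pdvd_sum => i hi; apply: pint_invS => //; lia. Qed.

(** First-order expansion in p of C(p-1,k), the product of the factors p/j - 1 for j = 1..k. *)
Lemma bin_predn_congr (p k : nat) : prime p -> (k < p)%N ->
  pdvd p 2 ('C(p.-1, k)%:R - (-1) ^+ k * (1 - p%:R * harmonic k)).
Proof.
move=> pp; elim: k => [|k IHk] hk.
  by rewrite bin0 /harmonic big_nil mulr0 subr0 mulr1 subrr; apply: pdvd0.
have hk1 : k%:R + 1 != 0 :> rat by rewrite natr1 natr_neq0.
have -> : 'C(p.-1, k.+1)%:R = 'C(p.-1, k)%:R * (p%:R * (k%:R + 1)^-1 - 1) :> rat.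
  have := congr1 (fun i : nat => i%:R : rat) (mul_bin_left p.-1 k).
  rewrite !natrM natrB; last lia.
  rewrite -[in p%:R](prednK (prime_gt0 pp)) -!natr1 => e.
  apply: (mulfI hk1); rewrite e; by field.
have -> : harmonic k.+1 = harmonic k + (k%:R + 1)^-1 by rewrite /harmonic big_nat_recr.
have hi := pint_invS _ _ pp hk.
move: IHk => /(_ (ltnW hk)).
have hH := pint_harmonic _ _ pp (ltnW hk).
have hs := pint_sign p k.
rewrite exprS.
move: (harmonic k) ((-1) ^+ k) 'C(p.-1, k)%:R ((k%:R + 1)^-1) hi hH hs.
move=> H s B i hi hH hs hB.
rewrite (_ : _ - _ = (B - s * (1 - p%:R * H)) * (p%:R * i - 1)
                     - p%:R * p%:R * (s * H * i)); last by ring.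
apply: pdvdB; apply: pdvdMr => //.
- apply: pdvdB; last exact: (pint_nat p 1).
  by apply: pdvdMl => //; apply: pint_nat.
- by apply: (@pdvdM p 1 1); apply: pdvd_prime.
- by do 2?apply: pdvdMl.
Qed.

Lemma bin_predn_congr1 (p k : nat) : prime p -> (k < p)%N ->
  pdvd p 1 ('C(p.-1, k)%:R - (-1) ^+ k).
Proof.
move=> pp hk; rewrite (_ : _ - _ =
  ('C(p.-1, k)%:R - (-1) ^+ k * (1 - p%:R * harmonic k))
  - p%:R * ((-1) ^+ k * harmonic k)); last by ring.
apply: pdvdB; first by apply: (@pdvdW p 1 2) => //; apply: bin_predn_congr.
apply: pdvdMr; first exact: pdvd_prime.
by apply: pdvdMl; [apply: pint_sign | apply: pint_harmonic].
Qed.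

(** Both sides are 1/(m+1) + ... + 1/(2m). The denominators 2m-j are kept because 2m-j and j+1 add
    up to 2m+1, which will be p. *)
Lemma alternating_harmonic (m : nat) :
  \sum_(0 <= j < 2 * m) (-1) ^+ j / (j%:R + 1) =
  \sum_(0 <= j < m) ((2 * m)%:R - j%:R)^-1 :> rat.
Proof.
(* Reversed, the right-hand sum loses its first term and gains two at the end when m grows, which
   suits induction. *)
transitivity (\sum_(0 <= j < m) (m%:R + j%:R + 1)^-1 : rat); last first.
  rewrite big_nat_rev; apply: eq_big_nat => j hj.
  have -> : (0 + m - j.+1 = m - j.+1)%N by lia.
  rewrite natrB; last lia.
  by congr (_ ^-1); rewrite natrM -natr1; ring.
elim: m => [|m IHm]; first by rewrite !big_nil.
have -> : (2 * m.+1 = (2 * m).+2)%N by lia.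
rewrite big_nat_recr // big_nat_recr //= IHm exprS exprM sqrrN !expr1n mulr1.
rewrite -[(2 * m).+1%:R]natr1 natrM.
case: m {IHm} => [|m].
  by rewrite !big_nil big_nat1.
rewrite [X in X + _ + _ = _]big_ltn // [RHS]big_nat_recr //.
rewrite [X in _ = X + _]big_nat_recr //=.
rewrite big_add1 /=.
rewrite (eq_bigr (fun j => (m.+2%:R + j%:R + 1)^-1 : rat)) => [|j _]; last first.
  by congr (_^-1); rewrite -!natr1; ring.
rewrite -![m.+2%:R]natr1 -![m.+1%:R]natr1.
have m0 := ler0n rat m.
by field; apply/and3P; split; apply: lt0r_neq0; lra.
Qed.

(** Expand 2^p = (1+1)^p with C(p,i+1) = p C(p-1,i) / (i+1), where C(p-1,i) is (-1)^i mod p. The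
    resulting alternating harmonic sum is -H_m mod p. *)
Lemma expr2_pred_congr (p m : nat) : prime p -> p = (2 * m).+1 ->
  pdvd p 2 (2 * 4 ^+ m - (2 - p%:R * harmonic m)).
Proof.
move=> pp ep.
have -> : 2 * 4 ^+ m = (2 ^ p)%:R :> rat.
  by rewrite ep natrX exprS exprM -natrX.
rewrite -(addn1 1) expnDn.
rewrite -(big_mkord predT (fun i => 'C(p, i) * (1 ^ (p - i) * 1 ^ i))%N).
rewrite natr_sum big_nat_recr //= big_ltn ?prime_gt0 // bin0 binn !exp1n.
rewrite big_add1 /=.
rewrite (_ : _ - _ =
  \sum_(0 <= i < p.-1) 'C(p, i.+1)%:R + p%:R * harmonic m); last first.
  under eq_bigr => i _ do rewrite !exp1n !muln1.
  by ring.
have -> : \sum_(0 <= i < p.-1) 'C(p, i.+1)%:R =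
    p%:R * \sum_(0 <= i < p.-1) ('C(p.-1, i)%:R - (-1) ^+ i) / (i%:R + 1)
    + p%:R * \sum_(0 <= i < p.-1) (-1) ^+ i / (i%:R + 1) :> rat.
  rewrite -mulrDr -big_split mulr_sumr; apply: eq_big_nat => i hi /=.
  have := congr1 (fun i : nat => i%:R : rat) (mul_bin_diag p i).
  rewrite !natrM -natr1 => e.
  have hi1 : i%:R + 1 != 0 :> rat by rewrite natr1 natr_neq0.
  by apply: (mulfI hi1); rewrite -e; field.
rewrite -addrA -mulrDr; apply: pdvdD; apply: (@pdvdM p 1 1); try exact: pdvd_prime.
  apply: pdvd_sum => i hi; apply: pdvdMr; first by apply: bin_predn_congr1 => //; lia.
  by apply: pint_invS => //; lia.
have -> : p.-1 = (2 * m)%N by rewrite ep.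
(* Pairing gives 1/(j+1) + 1/(2m-j) = p / ((j+1)(2m-j)). *)
rewrite alternating_harmonic /harmonic -big_split; apply: pdvd_sum => j hj /=.
have hj1 : j%:R + 1 != 0 :> rat by rewrite natr1 natr_neq0.
have ej : (2 * m)%:R - j%:R = (2 * m - j)%:R :> rat by rewrite natrB //; lia.
have hj2 : (2 * m)%:R - j%:R != 0 :> rat by rewrite ej natr_neq0 //; lia.
rewrite (_ : _ + _ = p%:R * ((j%:R + 1)^-1 * ((2 * m)%:R - j%:R)^-1)); last first.
  by rewrite ep -natr1; move: hj2; rewrite natrM => hj2; field; rewrite hj1 hj2.
apply: pdvdMr; first exact: pdvd_prime.
apply: pdvdMl; first by apply: pint_invS => //; lia.
by rewrite ej; apply: pint_inv; [lia | apply: coprime_small => //; lia].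
Qed.

Lemma pint_half (p m : nat) : p = (2 * m).+1 -> pdvd p 0 2^-1.
Proof. by move=> ep; apply: (@pint_inv p 2) => //; rewrite coprimen2; lia. Qed.

(** Fermat's little theorem for 2^(p-1) = 4^m, read off modulo p from the expansion of 2^p. *)
Lemma fermat_quotient_congr (p m : nat) : prime p -> p = (2 * m).+1 ->
  pdvd p 1 (4 ^+ m - 1).
Proof.
move=> pp ep.
rewrite (_ : _ - _ =
  2^-1 * ((2 * 4 ^+ m - (2 - p%:R * harmonic m)) - p%:R * harmonic m)); last by field.
apply: pdvdMl; first exact: pint_half ep.
apply: pdvdB; first by apply: (@pdvdW p 1 2) => //; apply: expr2_pred_congr.
apply: pdvdMr; [exact: pdvd_prime | by apply: pint_harmonic => //; lia].
Qed.

(** With u = 4^m, C(p-1,m) is (-1)^m (1 - p H_m), and 1 - p H_m is 2u - 1 = u^2 - (u-1)^2 modulo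
    p^2, where p^2 divides (u-1)^2. *)
Lemma morley_mod_p2 (p m : nat) : prime p -> p = (2 * m).+1 ->
  pdvd p 2 ('C(p.-1, m)%:R - (-1) ^+ m * (4 ^+ m) ^+ 2).
Proof.
move=> pp ep; have ltmp : (m < p)%N by lia.
have hB := bin_predn_congr _ _ pp ltmp.
have hu := expr2_pred_congr _ _ pp ep.
have hu1 := fermat_quotient_congr _ _ pp ep.
have hs := pint_sign p m; have hH := pint_harmonic _ _ pp ltmp.
move: (4 ^+ m) ((-1) ^+ m) (harmonic m) 'C(p.-1, m)%:R hB hu hu1 hs hH.
move=> u s H B hB hu hu1 hs hH.
rewrite (_ : _ - _ = (B - s * (1 - p%:R * H))
  - s * ((2 * u - (2 - p%:R * H)) + (u - 1) * (u - 1))); last by ring.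
apply: pdvdB => //; apply: pdvdMl => //; apply: pdvdD => //.
exact: (@pdvdM p 1 1).
Qed.

(** C(p+j,j) is the product of the factors 1 + p/i for i = 1..j, each 1 modulo p. *)
Lemma bin_addp_congr (p j : nat) : prime p -> (j < p)%N ->
  pdvd p 1 ('C(p + j, j)%:R - 1).
Proof.
move=> pp; elim: j => [|j IHj] hj; first by rewrite bin0 subrr; apply: pdvd0.
have hj1 : j%:R + 1 != 0 :> rat by rewrite natr1 natr_neq0.
have -> : 'C(p + j.+1, j.+1)%:R = 'C(p + j, j)%:R * (1 + p%:R * (j%:R + 1)^-1) :> rat.
  have := congr1 (fun i : nat => i%:R : rat) (mul_bin_diag (p + j.+1) j).
  rewrite !natrM addnS /= -!natr1 natrD => e.
  by apply: (mulfI hj1); rewrite -e; field.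
rewrite (_ : _ - _ = ('C(p + j, j)%:R - 1)
  + p%:R * ('C(p + j, j)%:R * (j%:R + 1)^-1)); last by ring.
apply: pdvdD; first by apply: IHj; lia.
apply: pdvdMr; first exact: pdvd_prime.
by apply: pdvdMl; [apply: pint_nat | apply: pint_invS].
Qed.

(* Both sides are the binomial coefficient of [-1/2 = m] modulo [p]. *)
Lemma central_bin_congr (p m k : nat) : prime p -> p = (2 * m).+1 -> (k < p)%N ->
  pdvd p 1 ('C(2 * k, k)%:R / (-4) ^+ k - 'C(m, k)%:R).
Proof.
move=> pp ep; elim: k => [|k IHk] hk.
  by rewrite muln0 !bin0 divr1 subrr; apply: pdvd0.
have hk1 : k%:R + 1 != 0 :> rat by rewrite natr1 natr_neq0.
have -> : 'C(m, k.+1)%:R = 'C(m, k)%:R * (m%:R - k%:R) / (k%:R + 1) :> rat.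
  have := congr1 (fun i : nat => i%:R : rat) (mul_bin_left m k).
  rewrite !natrM -natr1 => e; apply: (mulfI hk1); rewrite e.
  have [h|h] := leqP k m; first by rewrite natrB //; field.
  by rewrite bin_small // !mulr0 !mul0r mulr0.
(* The ratios of consecutive terms are -(2k+1)/(2(k+1)) and (m-k)/(k+1); they agree modulo p since
   2(m-k) = p - (2k+1). *)
rewrite (_ : _ - _ =
  - (('C(2 * k, k)%:R / (-4) ^+ k - 'C(m, k)%:R)
     * ((2 * k + 1)%:R * (2^-1 * (k%:R + 1)^-1)))
  - p%:R * ('C(m, k)%:R * (2^-1 * (k%:R + 1)^-1))); last first.
  by rewrite central_binS exprS ep -natr1 natrD !natrM; field; rewrite hk1 expf_neq0.
have hi : pdvd p 0 (2^-1 * (k%:R + 1)^-1).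
  by apply: pdvdMl; [exact: pint_half ep | apply: pint_invS].
apply: pdvdB.
  apply: pdvdN; apply: pdvdMr; first by apply: IHk; lia.
  by apply: pdvdMl => //; apply: pint_nat.
by apply: pdvdMr; [exact: pdvd_prime | apply: pdvdMl => //; apply: pint_nat].
Qed.

(** * Partial fractions and reciprocals of odd numbers *)

(** By Pascal's rule the sum for m+1 at x is the sum for m at x minus the sum for m at x+1, and the
    products on the right obey the same relation. Positivity of x keeps denominators nonzero. *)
Lemma partial_fraction_sum (m : nat) (x : rat) : 0 < x ->
  \sum_(0 <= k < m.+1) (-1) ^+ k * 'C(m, k)%:R / (x + k%:R) =
  m`!%:R / \prod_(0 <= j < m.+1) (x + j%:R).
Proof.
elim: m x => [|m IHm] x x0; first by rewrite !big_nat1 bin0.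
have x1 : 0 < x + 1 by rewrite addr_gt0.
have xj j : 0 < x + j%:R by rewrite ltr_wpDr.
transitivity (\sum_(0 <= k < m.+1) (-1) ^+ k * 'C(m, k)%:R / (x + k%:R)
    - \sum_(0 <= k < m.+1) (-1) ^+ k * 'C(m, k)%:R / (x + 1 + k%:R)).
  have -> : \sum_(0 <= k < m.+1) (-1) ^+ k * 'C(m, k)%:R / (x + k%:R) =
      \sum_(0 <= k < m.+2) (-1) ^+ k * 'C(m, k)%:R / (x + k%:R).
    by rewrite [RHS]big_nat_recr //= bin_small // mulr0 mul0r addr0.
  rewrite big_nat_recl // [X in _ = X - _]big_nat_recl // !bin0 -addrA -sumrB.
  congr (_ + _); apply: eq_bigr => k _.
  rewrite binS natrD exprS -natr1 (_ : x + (k%:R + 1) = x + 1 + k%:R); last by ring.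
  by ring.
rewrite !IHm // big_ltn // big_add1 /= [X in _ - _ / X]big_nat_recr //=.
rewrite [X in _ = _ / X]big_ltn // big_add1 /= [X in _ = _ / (_ * X)]big_nat_recr //=.
rewrite (eq_bigr (fun j => x + 1 + j%:R)) => [|j _]; last by rewrite -natr1; ring.
set P := \prod_(0 <= i < m) _.
have P0 : P != 0.
  by rewrite prodf_seq_neq0; apply/allP => j _ /=; rewrite gt_eqF // ltr_wpDr.
rewrite factrS addr0 -natr1.
have m0 := ler0n rat m.
by field; rewrite P0 /= !lt0r_neq0 //; lra.
Qed.

Lemma half_integer_prod (m : nat) :
  \prod_(0 <= j < m.+1) (2^-1 + j%:R) =
  (2 * m%:R + 1) * 'C(2 * m, m)%:R * m`!%:R / (2 * 4 ^+ m) :> rat.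
Proof.
elim: m => [|m IHm]; first by rewrite big_nat1 bin0.
rewrite big_nat_recr //= IHm central_binS factrS exprS -natr1.
have h : m%:R + 1 != 0 :> rat by rewrite natr1 natr_neq0.
by field; rewrite h expf_neq0.
Qed.

(** The partial fraction identity at x = 1/2, as 2k+1 = 2(1/2 + k). *)
Lemma odd_reciprocal_sum (m : nat) :
  \sum_(0 <= k < m.+1) (-1) ^+ k * 'C(m, k)%:R / (2 * k%:R + 1) =
  4 ^+ m / ((2 * m%:R + 1) * 'C(2 * m, m)%:R) :> rat.
Proof.
transitivity (2^-1 * \sum_(0 <= k < m.+1)
    (-1) ^+ k * 'C(m, k)%:R / (2^-1 + k%:R) : rat).
  rewrite mulr_sumr; apply: eq_bigr => k _.
  have k0 := ler0n rat k.
  by field; rewrite !lt0r_neq0 //; lra.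
rewrite partial_fraction_sum // half_integer_prod.
have h : 2 * m%:R + 1 != 0 :> rat by rewrite -natrM natr1 natr_neq0.
have hb : 'C(2 * m, m)%:R != 0 :> rat by rewrite natr_neq0 // bin_gt0; lia.
have := @factr_neq0 m => hf.
by field; rewrite h hb hf expf_neq0.
Qed.

(** * The terms p t_k modulo p^2 *)

(** The t_k of the overview. For p = 2m+1 and k < p, only k = m makes 2k+1 divisible by p, hence the
    factor p that accompanies the term below. *)
Definition reduced_term (p k : nat) : rat :=
  'C(p.-1, k)%:R * 'C(p + 2 * k, 2 * k)%:R * ('C(2 * k, k)%:R / (-4) ^+ k)
  / (2 * k%:R + 1).

Lemma pint_odd_inv (p k : nat) : (0 < p)%N -> coprime p (2 * k).+1 ->
  pdvd p 0 (2 * k%:R + 1)^-1.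
Proof. by move=> p0 h; rewrite -natrM natr1; apply: pint_inv. Qed.

Lemma pint_invX4 (p m k : nat) : p = (2 * m).+1 -> pdvd p 0 (4 ^+ k)^-1.
Proof.
move=> ep; rewrite -natrX; apply: pint_inv; first by rewrite expn_gt0.
by apply: coprimeXr; rewrite (coprimeMr p 2 2) coprimen2; lia.
Qed.

Lemma invX_N4 (k : nat) : ((-4) ^+ k)^-1 = (-1) ^+ k / 4 ^+ k :> rat.
Proof. by rewrite -[-4]mulN1r exprMn invfM invr_sign. Qed.

(** Modulo p the three factors of the numerator are (-1)^k, 1 (as 2k < p) and C(m,k), while 2k+1 < p
    is invertible. *)
Lemma reduced_term_low (p m k : nat) : prime p -> p = (2 * m).+1 -> (k < m)%N ->
  pdvd p 2 (p%:R * reduced_term p k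
            - p%:R * ((-1) ^+ k * 'C(m, k)%:R / (2 * k%:R + 1))).
Proof.
move=> pp ep ltkm; rewrite -mulrBr; apply: (@pdvdM p 1 1); first exact: pdvd_prime.
rewrite /reduced_term -mulrBl; apply: pdvdMr; last first.
  by apply: pint_odd_inv; [lia | apply: coprime_small => //; lia].
have h1 := bin_predn_congr1 p k pp (ltac:(lia)).
have h2 := bin_addp_congr p (2 * k) pp (ltac:(lia)).
have h3 := central_bin_congr p m k pp ep (ltac:(lia)).
rewrite -[(-1) ^+ k in X in _ - X]mulr1.
apply: pdvd_mul_congr => //; try exact: pint_nat.
  by apply: pdvdMl; apply: pint_nat.
by apply: pdvd_mul_congr => //; [apply: pint_nat | apply: (pint_nat p 1)].
Qed.

(** p divides (2k)! but is coprime to k!^2. *)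
Lemma prime_dvd_central_bin (p k : nat) : prime p -> (k < p <= 2 * k)%N ->
  (p %| 'C(2 * k, k))%N.
Proof.
move=> pp /andP[ltkp lepk].
have cf : coprime p k`!.
  elim: k ltkp {lepk} => [|k IHk] hk; first by rewrite coprimen1.
  by rewrite factS coprimeMr IHk 1?ltnW // andbT coprime_small.
have := @bin_fact (2 * k) k (ltac:(lia)).
have -> : (2 * k - k = k)%N by lia.
move=> e; rewrite -(@Gauss_dvdl p _ (k`! * k`!)) ?coprimeMr ?cf // e.
by rewrite dvdn_fact // prime_gt0.
Qed.

Lemma reduced_term_high (p m k : nat) : prime p -> p = (2 * m).+1 ->
  (m < k < p)%N -> pdvd p 2 (p%:R * reduced_term p k).
Proof.
move=> pp ep /andP[ltmk ltkp]; apply: (@pdvdM p 1 1); first exact: pdvd_prime.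
apply: pdvdMr; last first.
  apply: pint_odd_inv; first lia.
  (* 2k+1 lies strictly between p and 2p. *)
  by rewrite prime_coprime //; apply/negP => /dvdnP[[|[|q]]]; nia.
apply: pdvdMl; first by apply: pdvdMl; apply: pint_nat.
apply: pdvdMr; first by apply: pdvd_nat; rewrite expn1 prime_dvd_central_bin //; lia.
rewrite invX_N4.
by apply: pdvdMl; [apply: pint_sign | apply: pint_invX4 ep].
Qed.

(** An exact identity: 2m+1 = p cancels the factor p, C(2m,m) = C(p-1,m) gives the square, and
    C(p+2m,2m) = C(2p-1,p-1) is half of C(2p,p). *)
Lemma reduced_term_mid (p m : nat) : p = (2 * m).+1 ->
  p%:R * reduced_term p m =
  (-1) ^+ m * 'C(p.-1, m)%:R ^+ 2 * ('C(2 * p, p)%:R / 2) / 4 ^+ m.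
Proof.
move=> ep; rewrite /reduced_term.
have -> : 'C(2 * p, p)%:R = 2 * 'C(p + 2 * m, 2 * m)%:R :> rat.
  have := mul_bin_diag (2 * p) (2 * m); rewrite -ep.
  have -> : ((2 * p).-1 = p + 2 * m)%N by lia.
  rewrite -mulnA mulnCA => /eqP; rewrite eqn_pmul2l; last lia.
  by move=> /eqP <-; rewrite natrM.
have -> : 2 * m%:R + 1 = p%:R :> rat by rewrite -natrM natr1 -ep.
have -> : (2 * m = p.-1)%N by lia.
have p0 : p%:R != 0 :> rat by rewrite natr_neq0; lia.
rewrite invX_N4.
by field; rewrite p0 expf_neq0.
Qed.

(** C(p-1,k) divides (p-1)!, which is coprime to p by Wilson's theorem. *)
Lemma coprime_bin_predn (p k : nat) : prime p -> (k < p)%N -> coprime p 'C(p.-1, k).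
Proof.
move=> pp ltkp; apply: (@coprime_dvdr _ p.-1`!).
  have := @bin_fact p.-1 k (ltac:(lia)) => <-; exact: dvdn_mulr.
apply: (@coprime_dvdl _ p.-1`!.+1); last exact: coprimeSn.
by have := Wilson (prime_gt1 pp); rewrite pp.
Qed.

Lemma reduced_sum_congr (p m : nat) : prime p -> p = (2 * m).+1 ->
  pdvd p 2 (p%:R * (\sum_(0 <= k < p) reduced_term p k)
    - ((-1) ^+ m * 'C(p.-1, m)%:R ^+ 2 * ('C(2 * p, p)%:R / 2) / 4 ^+ m
       + (4 ^+ m / 'C(p.-1, m)%:R - (-1) ^+ m))).
Proof.
move=> pp ep.
have p0 : p%:R != 0 :> rat by rewrite natr_neq0 // prime_gt0.
have em : 2 * m%:R + 1 = p%:R :> rat by rewrite -natrM natr1 -ep.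
have b0 : 'C(p.-1, m)%:R != 0 :> rat by rewrite natr_neq0 // bin_gt0; lia.
(* The term k = m of this sum is (-1)^m / p; moving it across leaves the sum over k < m and produces
   the -(-1)^m of the statement. *)
have := odd_reciprocal_sum m; rewrite big_nat_recr //= binn mulr1 em.
have -> : (2 * m = p.-1)%N by lia.
move=> /(canRL (addrK _)) => es.
have -> : 4 ^+ m / 'C(p.-1, m)%:R - (-1) ^+ m =
    p%:R * \sum_(0 <= k < m) (-1) ^+ k * 'C(m, k)%:R / (2 * k%:R + 1) :> rat.
  by rewrite es; field; rewrite p0 b0.
rewrite -reduced_term_mid // (@big_cat_nat _ _ _ m) //=; last lia.
rewrite (@big_ltn _ _ _ m) //; last lia.
rewrite (_ : _ - _ = \sum_(0 <= k < m) (p%:R * reduced_term p k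
     - p%:R * ((-1) ^+ k * 'C(m, k)%:R / (2 * k%:R + 1)))
  + \sum_(m.+1 <= k < p) p%:R * reduced_term p k); last first.
  by rewrite sumrB -!mulr_sumr; ring.
apply: pdvdD; apply: pdvd_sum => k hk; first by apply: reduced_term_low => //; lia.
by apply: (@reduced_term_high p m k) => //; lia.
Qed.

(** * Assembly modulo p^3 *)

Lemma franel_sum_pdvd (p m : nat) : prime p -> p = (2 * m).+1 ->
  pdvd p 3 (2 * p%:R ^+ 2 * 'C(2 * p, p)%:R / 4 ^+ p
    * (\sum_(0 <= k < p) reduced_term p k) - p%:R * (-1) ^+ m).
Proof.
move=> pp ep.
have hW := reduced_sum_congr _ _ pp ep.
have hB := morley_mod_p2 _ _ pp ep.
have hu1 := fermat_quotient_congr _ _ pp ep.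
have hc : pdvd p 2 ('C(2 * p, p)%:R / 2 - 1).
  rewrite (_ : _ - 1 = ('C(2 * p, p)%:R - 2) * 2^-1); last by field.
  by apply: pdvdMr; [apply: bin_2p_congr | apply: pint_half ep].
have hs := pint_sign p m.
have ss : (-1) ^+ m * (-1) ^+ m = 1 :> rat by rewrite -exprMn mulrNN mulr1 expr1n.
have hui := pint_invX4 _ _ m ep.
have u0 : 4 ^+ m != 0 :> rat by rewrite expf_neq0.
have hu : pdvd p 0 (4 ^+ m) by rewrite -natrX; apply: pint_nat.
have iB := pint_nat p 'C(p.-1, m).
have hBi : pdvd p 0 ('C(p.-1, m)%:R^-1).
  by apply: pint_inv; [rewrite bin_gt0; lia | apply: coprime_bin_predn => //; lia].
have B0 : 'C(p.-1, m)%:R != 0 :> rat by rewrite natr_neq0 // bin_gt0; lia.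
have -> : 4 ^+ p = 4 * (4 ^+ m) ^+ 2 :> rat by rewrite {1}ep exprS mulnC exprM.
move: hW hB hu1 hc hs ss hui u0 hu iB hBi B0.
rewrite -[2 * p%:R ^+ 2 * _]mulrA.
have -> : 'C(2 * p, p)%:R = 2 * ('C(2 * p, p)%:R / 2) :> rat by field.
rewrite [2 * (_ / 2) / 2](_ : _ = 'C(2 * p, p)%:R / 2); last by field.
move: (4 ^+ m) ((-1) ^+ m) 'C(p.-1, m)%:R ('C(2 * p, p)%:R / 2)
  (\sum_(0 <= k < p) reduced_term p k) => u s B c W.
move=> hW hB hu1 hc hs ss hui u0 hu iB hBi B0.
have hc0 : pdvd p 0 c by apply: pint_congr hc (pint_nat p 1).
rewrite (_ : _ - _ = p%:R * (u^-1 * u^-1 * (c * (p%:R * W)) - s)); last by field.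
apply: (@pdvdM p 1 2); first exact: pdvd_prime.
(* Here p W is replaced by what c = 1 and B = s u^2 make of it; the difference is s u^-3 (u-1)^2
   (u^2+u+1). *)
have h0 : pdvd p 2 (u^-1 * u^-1 * (s * u ^+ 3 + s * u^-1 - s) - s).
  rewrite (_ : _ - _ =
    (u - 1) * (u - 1) * (s * (u ^+ 2 + u + 1) * (u^-1 * u^-1 * u^-1))); last by field.
  apply: pdvdMr; first exact: (@pdvdM p 1 1).
  apply: pdvdMl; last by do 2!apply: pdvdMl => //.
  apply: pdvdMl => //; apply: pdvdD; last exact: (pint_nat p 1).
  by apply: pdvdD => //; rewrite expr2; apply: pdvdMl.
apply: pdvd_trans h0; rewrite -mulrBr; apply: pdvdMl; first exact: pdvdMl.
(* Morley's congruence squared and, in [h2], inverted, using s^2 = 1. *)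
have h1 : pdvd p 2 (B ^+ 2 - u ^+ 4).
  rewrite (_ : _ - _ = (B - s * u ^+ 2) * (B + s * u ^+ 2)); last first.
    transitivity (B ^+ 2 - s * s * u ^+ 4); first by rewrite ss mul1r.
    by ring.
  apply: pdvdMr => //; apply: pdvdD => //; apply: pdvdMl => //.
  by rewrite expr2; apply: pdvdMl.
have h2 : pdvd p 2 (B^-1 - s * u^-1 * u^-1).
  rewrite (_ : _ - _ = (B - s * u ^+ 2) * (- s * (B^-1 * (u^-1 * u^-1)))); last first.
    transitivity (s * s * B^-1 - s * u^-1 * u^-1); first by rewrite ss mul1r.
    by field; rewrite u0 B0.
  apply: pdvdMr => //; apply: pdvdMl; first exact: pdvdN.
  by do 2?apply: pdvdMl.
rewrite -[X in _ - X]mul1r; apply: pdvd_mul_congr => //.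
  apply: pdvdB => //; apply: pdvdD; last exact: pdvdMl.
  by rewrite 2!exprS expr1; do 3?apply: pdvdMl.
apply: pdvd_trans hW _.
rewrite (_ : _ - _ = s * u^-1 * (B ^+ 2 * (c - 1) + (B ^+ 2 - u ^+ 4))
   + u * (B^-1 - s * u^-1 * u^-1)); last by field; rewrite u0 B0.
apply: pdvdD; last exact: pdvdMl.
apply: pdvdMl; first exact: pdvdMl.
by apply: pdvdD => //; apply: pdvdMl => //; rewrite expr2; apply: pdvdMl.
Qed.

Theorem theorem1p2 (p : nat) (hp : prime p) (hodd : odd p) :
  rat_congr (p ^ 3)%N
    (\sum_(0 <= k < p)
        ((3 * k + 1)%:R / (-16 : rat) ^+ k * ('C(2 * k, k))%:R * (franel k)%:R))
    (p%:R * (-1 : rat) ^+ ((p - 1) %/ 2)%N).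
Proof.
apply: pdvd_rat_congr => //; rewrite franel_sumE.
by apply: franel_sum_pdvd => //; lia.
Qed.
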